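(* For all $k\geq 2$ and all $n\geq0$, there is no even involution in $\mathfrak{S}_n$ that contains $132$ exactly once and contains $12\cdots k$ exactly once, and there is no even involution in $\mathfrak{S}_n$ that contains $132$ exactly once and contains $23\cdots k1$ exactly once; that is, $\sum_{n}J^e_{12\cdots k;1}(n)x^n=\sum_n J^e_{23\cdots k1;1}(n)x^n=0$.
   Context: $12\cdots k$ is the identity permutation of length $k$ and $23\cdots k1$ is the permutation $(2,3,\dots,k,1)$. An occurrence of a pattern $\tau\in\mathfrak{S}_m$ in $\pi\in\mathfrak{S}_n$ is an index set $i_1<\dots<i_m$ with $\pi_{i_1}\cdots\pi_{i_m}$ order-isomorphic to $\tau$. $J^e_{\tau;r}(n)$ is the number of even involutions $\pi\in\mathfrak{S}_n$ ($\pi=\pi^{-1}$ with an even number of inversions, pairs $i<j$ with $\pi_i>\pi_j$) containing $132$ exactly once and $\tau$ exactly $r$ times. *)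

(* Defs.v *)
From mathcomp Require Import all_boot all_fingroup.

Set Implicit Arguments.
Unset Strict Implicit.
Unset Printing Implicit Defensive.

(* A permutation of length n is an element of 'S_n, with positions and values
   shifted to {0, ..., n-1}; its one-line notation is s 0, s 1, ..., s (n-1). *)

Definition inversions n (s : 'S_n) : nat :=
  #|[set p : 'I_n * 'I_n | (p.1 < p.2) && (s p.2 < s p.1)]|.

Definition even_involution n (s : 'S_n) : bool :=
  (s == s^-1)%g && ~~ odd (inversions s).

(* The index set i_1 < ... < i_m is encoded as the strictly increasing map
   f : a |-> i_a. *)
Definition occurrence m n (tau : 'S_m) (s : 'S_n) (f : {ffun 'I_m -> 'I_n}) :
    bool :=
  [forall a : 'I_m, forall b : 'I_m, (a < b) ==> (f a < f b)]
  && [forall a : 'I_m, forall b : 'I_m, (s (f a) < s (f b)) == (tau a < tau b)].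

Definition occurrences m n (tau : 'S_m) (s : 'S_n) : nat :=
  #|[set f : {ffun 'I_m -> 'I_n} | occurrence tau s f]|.

Definition pat132 : 'S_3 :=
  tperm (Ordinal (isT : 1 < 3)) (Ordinal (isT : 2 < 3)).

(* 12...k *)
Definition pat_id k : 'S_k := 1%g.

(* 23...k1 : ordS sends i to i.+1 %% k. *)
Definition pat_shift k : 'S_k := perm (@ordS_inj k).

Definition J_even m (tau : 'S_m) (r n : nat) : nat :=
  #|[set s : 'S_n | [&& even_involution s, occurrences pat132 s == 1
                      & occurrences tau s == r]]|.

(* Main.v *)
(* Inversion maps occurrences of 132 in an involution [s] to occurrences of 132,
   so the only one sits on a fixed point [i] and a 2-cycle [j < l] with [i < j].
   Its uniqueness forces all other fixed points to exceed [l] and all other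
   2-cycles to open before [i] and to close after [j].  The only occurrence of
   12...k is likewise made of fixed points, and its first letter can be replaced
   by position [j], which is a second occurrence.  An occurrence of 23...k1 with
   [k >= 3] can also be altered by inverting its increasing part or by moving its
   first or last letter.  Parity matters only for 21: a permutation with a single
   inversion is odd. *)

Require Import Defs.
From mathcomp Require Import all_boot all_fingroup.
From mathcomp Require Import zify.

(** * Unique occurrences as explicit tuples of positions *)

Lemma occurrences_eq1 m n (tau : 'S_m) (s : 'S_n) :
  occurrences tau s = 1 ->
  exists2 f, occurrence tau s f & forall g, occurrence tau s g -> g = f.
Proof.
move=> /eqP/cards1P[f fE]; exists f => [|g sg].
  by have := set11 f; rewrite -fE inE.
by apply/set1P; rewrite -fE inE.
Qed.

Lemma occurrenceP m n (tau : 'S_m) (s : 'S_n) (f : {ffun 'I_m -> 'I_n}) :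
  reflect ((forall a b : 'I_m, a < b -> f a < f b) /\
           (forall a b : 'I_m, (s (f a) < s (f b)) = (tau a < tau b)))
          (occurrence tau s f).
Proof.
apply: (iffP andP) => -[f_mono f_pat]; split.
- by move=> a b; apply/implyP; exact: (forallP (forallP f_mono a) b).
- by move=> a b; exact: (eqP (forallP (forallP f_pat a) b)).
- by apply/forallP => a; apply/forallP => b; apply/implyP/f_mono.
- by apply/forallP => a; apply/forallP => b; rewrite f_pat.
Qed.

Definition is132 {n} (s : 'S_n) (a b c : 'I_n) : Prop :=
  [/\ a < b, b < c, s a < s c & s c < s b].

Lemma pat132_unique n (s : 'S_n) :
  occurrences pat132 s = 1 ->
  exists i j l, is132 s i j l /\
    forall a b c, is132 s a b c -> [/\ a = i, b = j & c = l].
Proof.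
case/occurrences_eq1 => f /occurrenceP[f_mono f_pat] f_uniq.
have patE : forall x : 'I_3, pat132 x = nth 0 [:: 0; 2; 1] x :> nat.
  by move=> [[|[|[|x]]] ltx] //; rewrite /pat132 permE.
pose o x ltx : 'I_3 := @Ordinal 3 x ltx.
exists (f (o 0 isT)), (f (o 1 isT)), (f (o 2 isT)); split.
  by split; rewrite ?f_mono ?f_pat ?patE.
move=> a b c [ab bc sac scb].
pose g : {ffun 'I_3 -> 'I_n} := [ffun x : 'I_3 => nth a [:: a; b; c] x].
suff /f_uniq <- : occurrence pat132 s g by rewrite !ffunE.
apply/occurrenceP; split.
  by move=> [[|[|[|x]]] ?] [[|[|[|y]]] ?] //; rewrite !ffunE /=; lia.
move=> [[|[|[|x]]] ?] [[|[|[|y]]] ?] //; rewrite !ffunE !patE /=; lia.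
Qed.

Lemma pat_id_unique n k (s : 'S_n) :
  occurrences (pat_id k) s = 1 ->
  exists2 f : 'I_k -> 'I_n,
    forall a b : 'I_k, a < b -> f a < f b /\ s (f a) < s (f b) &
    forall g : 'I_k -> 'I_n,
      (forall a b : 'I_k, a < b -> g a < g b /\ s (g a) < s (g b)) -> g =1 f.
Proof.
case/occurrences_eq1 => f /occurrenceP[f_mono f_pat] f_uniq.
exists f => [a b ab | g g_mono x].
  by rewrite f_pat !perm1 f_mono.
have /f_uniq <- : occurrence (pat_id k) s [ffun x => g x]; last by rewrite ffunE.
apply/occurrenceP; split=> a b; rewrite !ffunE; first by case/g_mono.
rewrite !perm1; case: (ltngtP a b) => [/g_mono[]//|/g_mono[_]|/val_inj->].
  by move/ltnW; rewrite leqNgt => /negbTE.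
by rewrite ltnn.
Qed.

(* [X 0, ..., X m.-1, y] are the positions of an occurrence of 23...(m+1)1. *)
Definition is_shift {n} (s : 'S_n) m (X : nat -> 'I_n) (y : 'I_n) : Prop :=
  (forall a b, a < b < m -> X a < X b /\ s (X a) < s (X b)) /\
  (forall a, a < m -> X a < y /\ s y < s (X a)).

(** Uniqueness of the function [X] is asserted only below [m], the range on which [is_shift]
    constrains it. *)
Lemma pat_shift_unique n m (s : 'S_n) :
  occurrences (pat_shift m.+1) s = 1 ->
  exists X y, is_shift s m X y /\
    forall X' y', is_shift s m X' y' ->
      (forall a, a < m -> X' a = X a) /\ y' = y.
Proof.
case/occurrences_eq1 => f /occurrenceP[f_mono f_pat] f_uniq.
(* The last index [m] wraps around to 0, the closing letter 1 of the pattern. *)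
have patE (x : 'I_m.+1) : pat_shift m.+1 x = (if x < m then x.+1 else 0) :> nat.
  rewrite permE /=; case: ltnP => [xm|mx]; first by rewrite modn_small.
  by have -> : x = m :> nat by [apply/eqP; rewrite eqn_leq mx -ltnS ltn_ord]; rewrite modnn.
exists (fun a => f (inord a)), (f ord_max); split.
  split=> [a b /andP[ab bm]|a am].
    have am := ltn_trans ab bm.
    have [am' bm'] : a < m.+1 /\ b < m.+1 by lia.
    by rewrite f_mono ?f_pat ?patE ?inordK ?am ?bm //.
  have am' : a < m.+1 by lia.
  by rewrite f_mono ?f_pat ?patE ?inordK //= ?am ?ltnn.
move=> X y [X_mono Xy].
pose g : {ffun 'I_m.+1 -> 'I_n} := [ffun x : 'I_m.+1 => if x < m then X x else y].
have /f_uniq gf : occurrence (pat_shift m.+1) s g.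
  apply/occurrenceP; split=> a b; rewrite !ffunE.
    have [bm|mb] := ltnP b m => ab; last first.
      by have am : a < m by [have := ltn_ord b; lia]; rewrite am; case: (Xy a).
    by rewrite (ltn_trans ab bm); case: (X_mono a b); rewrite ?ab.
  rewrite !patE; case: (ltnP a m) => am; case: (ltnP b m) => bm; rewrite ?ltnn //.
  - rewrite ltnS; case: (ltngtP a b) => [ab|ba|->]; last by rewrite ltnn.
      by case: (X_mono a b); rewrite ?ab.
    by case: (X_mono b a) => [|_]; rewrite ?ba //; lia.
  - by case: (Xy a am); lia.
  - by case: (Xy b bm) => _ ->.
rewrite -gf; split=> [a am|]; rewrite ffunE /= ?ltnn // inordK ?am //; lia.
Qed.

(** An occurrence of 21 is the same thing as an inversion. *)
Lemma pat_shift2_once n (s : 'S_n) :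
  occurrences (pat_shift 2) s = 1 -> inversions s = 1.
Proof.
case/pat_shift_unique => X [y [[_ /(_ 0 isT) Xy] X_uniq]].
apply/eqP/cards1P; exists (X 0, y); apply/setP => -[b c]; rewrite !inE /=.
apply/idP/eqP => [bc|[-> ->]]; last exact/andP.
have [|E ->] := X_uniq (fun=> b) c; last by rewrite (E 0).
by split=> [a a'|a _]; [lia | apply/andP].
Qed.

(** * Fixed points and 2-cycles of an involution with a single 132 *)

Section Involution132.

Variables (n : nat) (s : 'S_n).
Hypothesis sK : involutive s.
Variables i j l : 'I_n.
Hypothesis ijl : is132 s i j l.
Hypothesis ijl_uniq : forall a b c, is132 s a b c -> [/\ a = i, b = j & c = l].

Let ord_neq (t u : 'I_n) : t <> u -> t <> u :> nat.
Proof. by move=> tu /val_inj. Qed.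

(* The inverse of an occurrence of 132 is again one, hence the same one. *)
Lemma unique132_fixed : [/\ s i = i, s j = l & s l = j].
Proof.
have [ij jl sil slj] := ijl.
by have [|-> -> ->] := ijl_uniq (s i) (s l) (s j); first by split; rewrite ?sK.
Qed.

(** Otherwise [t] could replace [i] in the occurrence [i], [j], [l]; the value [j] itself is taken
    by [l]. *)
Lemma lt_fixed_image (t : 'I_n) : t < i -> j < s t.
Proof.
have [[ij jl _ _] [si sj sl]] := (ijl, unique132_fixed) => ti.
rewrite ltnNge; apply/negP => stj.
have /ord_neq tl : s t <> j by move=> E; have := sK t; rewrite E sj => F; move: ti; rewrite -F; lia.
have [] := ijl_uniq t j l; first by split; rewrite ?sj ?sl; lia.
by move=> E; move: ti; rewrite E ltnn.
Qed.

(** A fixed point strictly between [i] and [j] could replace [i], and one strictly between [j] and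
    [l] could replace [l]. *)
Lemma fixed_gt (t : 'I_n) : s t = t -> i <= t /\ (i < t -> l < t).
Proof.
have [[ij jl _ _] [si sj sl]] := (ijl, unique132_fixed) => st.
have [ti|it] := ltnP t i; first by have := lt_fixed_image t ti; rewrite st; lia.
split=> // {}it; rewrite ltnNge; apply/negP => tl.
have /ord_neq tj : t <> j by move=> E; move: st jl; rewrite E sj => ->; rewrite ltnn.
have /ord_neq tl' : t <> l by move=> E; move: st jl; rewrite E sl => ->; rewrite ltnn.
have [tltj|jt] := ltnP t j.
  have [E _ _] : [/\ t = i, j = j & l = l] by apply: ijl_uniq; split; rewrite ?sj ?sl ?st; lia.
  by move: it; rewrite E ltnn.
by case: (ijl_uniq i j t) => [|_ _ /(congr1 val)//]; split; rewrite ?sj ?si ?st; lia.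
Qed.

(** If [i < t < s t], then [i], [t], [s t] are the positions of a 132. *)
Lemma excedance (t : 'I_n) : t < s t -> t < i \/ t = j.
Proof.
have [[ij jl _ _] [si sj sl]] := (ijl, unique132_fixed) => tst.
have [|it] := ltnP t i; [by left | right].
have /ord_neq ti : t <> i by move=> E; move: tst; rewrite E si ltnn.
by case: (ijl_uniq i t (s t)) => //; split; rewrite ?sK ?si; lia.
Qed.

(** A [t] strictly in between could replace [i] when [s t < j], and is a forbidden excedance
    otherwise. *)
Lemma between_fixed_swap (t : 'I_n) : i < t <= j -> t = j.
Proof.
have [[ij jl _ _] [si sj sl]] := (ijl, unique132_fixed) => /andP[it tj].
case: (eqVneq t j) => // /eqP/ord_neq ntj.
have [stj|jst] := ltnP (s t) j.
  case: (ijl_uniq t j l) => [|E _ _]; first by split; rewrite ?sj ?sl; lia.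
  by move: it; rewrite E ltnn.
by case: (excedance t) => //; lia.
Qed.

(** * The patterns 12...k and 23...k1 in such an involution *)

Lemma pat_id_not_once k : 0 < k -> occurrences (pat_id k) s <> 1.
Proof.
have [[ij jl _ _] [si sj sl]] := (ijl, unique132_fixed).
case: k => // k _ /pat_id_unique[f f_mono f_uniq].
have sf a : s (f a) = f a.
  by apply: (f_uniq (s \o f)) => b c bc /=; rewrite !sK; case: (f_mono b c bc).
have fl (a : 'I_k.+1) : 0 < a -> l < f a.
  move=> a0; have [] := f_mono ord0 a a0.
  by have [[_ +] [+ _]] := (fixed_gt _ (sf a), fixed_gt _ (sf ord0)); lia.
(* The value [l] at [j] is still below all later letters, which are fixed points beyond [l]. *)
pose g (a : 'I_k.+1) := if a == ord0 then j else f a.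
have gf : g =1 f.
  apply: f_uniq => a b ab; rewrite /g.
  have b0 : 0 < b by lia.
  have -> : (b == ord0) = false by apply/negbTE; rewrite -lt0n.
  case: eqP => _; last exact: f_mono.
  by rewrite sj sf; have := fl b b0; lia.
by have := sf ord0; rewrite -gf /g /= sj; move=> E; move: jl; rewrite E ltnn.
Qed.

Lemma pat_shift_not_once k : 2 < k -> occurrences (pat_shift k) s <> 1.
Proof.
have [[ij jl _ _] [si sj sl]] := (ijl, unique132_fixed).
case: k => [|[|[|m]]] // _ /pat_shift_unique[X [y [[X_mono Xy] X_uniq]]].
have [X0y syX0] := Xy 0 isT.
have [Xmy syXm] := Xy m.+1 (ltnSn _).
have [X0m sX0m] : X 0 < X m.+1 /\ s (X 0) < s (X m.+1) by apply: X_mono; rewrite /= ltnS.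
have geX0 a : a < m.+2 -> X 0 <= X a /\ s (X 0) <= s (X a).
  by case: a => [|a] am //; case: (X_mono 0 a.+1) => //; split; lia.
have leXm a : a < m.+2 -> X a <= X m.+1 /\ s (X a) <= s (X m.+1).
  move=> am; case: (ltngtP a m.+1) => [am'| |->] //; last lia.
  by case: (X_mono a m.+1) => //; [rewrite am' /= | split; lia].
(* The two replacement rules: [z] as a new last letter, then [z] as a new first letter. *)
have last_uniq (z : 'I_n) : X m.+1 < z -> s z < s (X 0) -> z = y.
  move=> Xz szX; apply: (X_uniq X z _).2; split=> // a am.
  by have [[? ?] [? ?]] := (geX0 a am, leXm a am); lia.
have first_uniq (z : 'I_n) : z < X 1 -> s y < s z -> s z < s (X 1) -> z = X 0.
  move=> zX1 sysz szX1.
  have ge1 a : a < m.+2 -> 0 < a -> X 1 <= X a /\ s (X 1) <= s (X a).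
    by case: a => [|[|a]] am //; case: (X_mono 1 a.+2) => //; split; lia.
  have [] // := X_uniq (fun a => if a == 0 then z else X a) y.
    split=> [[|a] [|b] // /andP[ab bm]|[|a] am] /=.
    - by have [] := ge1 b.+1 bm isT; lia.
    - by apply: X_mono; rewrite ab.
    - by have [X1y _] := Xy 1 isT; lia.
    - exact: Xy.
  by move=> E _; rewrite -(E 0).
(* The condition makes the inverted increasing part end before [y] and its top value exceed [s y];
   only its lowest value [X 0] remains to be compared with [s y]. *)
have [/andP[sXmy syXm']|] := boolP ((s (X m.+1) < y) && (s y < X m.+1)).
  have [X0sy|syX0'] := ltnP (X 0) (s y).
    (* Here [X 0], [s y], [X m.+1] would be a 132 whose last position is [l], although [y = l]
       too. *)
    case: (ijl_uniq (X 0) (s y) (X m.+1)) => [|_ E1 E2]; first by split; rewrite ?sK; lia.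
    have : y = l by rewrite -(sK y) E1 sj.
    by rewrite -E2 => E; move: Xmy; rewrite E ltnn.
  have /ord_neq sy_neq : s y <> X 0.
    by move=> E; move: sX0m; rewrite -E sK; lia.
  (* Inverting the increasing part while keeping [y] gives an occurrence again, so every [X a] is
     fixed. *)
  have sX a : a < m.+2 -> s (X a) = X a.
    apply: (X_uniq (s \o X) y _).1; split=> b /= => [c bc|bm]; rewrite !sK.
      by case: (X_mono b c bc).
    by have [[? ?] [? ?]] := (geX0 b bm, leXm b bm); lia.
  have X01 : X 0 < X 1 by case: (X_mono 0 1).
  have iX0 : i <= X 0 by case: (fixed_gt _ (sX 0 isT)).
  have lX1 : l < X 1 by case: (fixed_gt _ (sX 1 isT)) => _; apply; lia.
  have syi : s y < i.
    have [|//|sy_j] := excedance (s y); first by rewrite sK; lia.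
    have [X1y _] := Xy 1 isT.
    by move: X1y; rewrite -(sK y) sy_j sj; lia.
  have jX0 : j = X 0 by apply: first_uniq; rewrite ?sj ?(sX 1) //; lia.
  by have := sX 0 isT; rewrite -jX0 sj => E; move: jl; rewrite E ltnn.
(* Either failure, [y <= s (X m.+1)] or [X m.+1 <= s y], makes [X m.+1] an excedance, hence before
   [i] or equal to [j]. *)
move=> nC; have excm : X m.+1 < s (X m.+1) by lia.
have [Xmi|Xmj] := excedance _ excm.
  have := lt_fixed_image (X 0) (ltn_trans X0m Xmi) => jX0.
  (* Both [i] and [l] can serve as the last letter. *)
  have iy : i = y by apply: last_uniq; rewrite ?si; lia.
  have ly : l = y by apply: last_uniq; rewrite ?sl; lia.
  by move: ij jl; rewrite iy ly; lia.
have [X0i|iX0] := ltnP (X 0) i.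
  have jX0 := lt_fixed_image (X 0) X0i.
  have ly : l = y by apply: last_uniq; rewrite ?sl ?Xmj; lia.
  (* Both [l] and [s (X 0)] can serve as the last letter, so [X 0] and [j] would share the image
     [l]. *)
  have E : s (X 0) = y by apply: last_uniq; rewrite ?sK ?Xmj //; lia.
  by move: sX0m; rewrite Xmj sj E ly ltnn.
have X0E : X 0 = i.
  have [iX|] := ltnP i (X 0); last by move=> X0i; apply: val_inj; apply/eqP; rewrite eqn_leq X0i.
  have E : X 0 = j by apply: between_fixed_swap; rewrite -Xmj iX ltnW.
  by move: X0m; rewrite Xmj E ltnn.
have X1E : X 1 = j.
  apply: between_fixed_swap; rewrite -Xmj -X0E; case: (leXm 1 isT) => -> _.
  by rewrite andbT; case: (X_mono 0 1).
move: nC syX0 Xmy; rewrite Xmj sj X0E si => nC syi jy.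
(* Now [X 0 = i] and [X 1 = j]. The negated condition gives [y <= l], so for [y <> l] the position
   [s y], of value [y < l], can serve as the first letter although it lies before [i]. *)
have /ord_neq yl : y <> l by move=> E; move: syi; rewrite E sl; lia.
have E : s y = X 0 by apply: first_uniq; rewrite ?X1E ?sj ?sK; lia.
by move: syi; rewrite E X0E ltnn.
Qed.

End Involution132.

Theorem theorem3p25 (k n : nat) (hk : 2 <= k) :
  [/\ ~ (exists s : 'S_n, [/\ even_involution s,
           occurrences pat132 s = 1 & occurrences (pat_id k) s = 1]),
      ~ (exists s : 'S_n, [/\ even_involution s,
           occurrences pat132 s = 1 & occurrences (pat_shift k) s = 1]),
      J_even (pat_id k) 1 n = 0
    & J_even (pat_shift k) 1 n = 0].
Proof.
have not_id : ~ (exists s : 'S_n, [/\ even_involution s,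
    occurrences pat132 s = 1 & occurrences (pat_id k) s = 1]).
  case=> s [/andP[/eqP sV _] /pat132_unique[i [j [l [ijl ijl_uniq]]]]].
  have sK : involutive s by move=> x; rewrite {1}sV permK.
  by apply: (pat_id_not_once _ _ sK _ _ _ ijl ijl_uniq); lia.
have not_shift : ~ (exists s : 'S_n, [/\ even_involution s,
    occurrences pat132 s = 1 & occurrences (pat_shift k) s = 1]).
  case=> s [/andP[/eqP sV s_even] /pat132_unique[i [j [l [ijl ijl_uniq]]]]].
  have sK : involutive s by move=> x; rewrite {1}sV permK.
  have [->|k2] := eqVneq k 2.
    by move/pat_shift2_once => inv1; rewrite inv1 in s_even.
  by apply: (pat_shift_not_once _ _ sK _ _ _ ijl ijl_uniq); lia.
split=> //; apply/eqP; rewrite cards_eq0; apply/eqP/setP => s; rewrite !inE.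
  by apply/negP => /and3P[? /eqP ? /eqP ?]; apply: not_id; exists s.
by apply/negP => /and3P[? /eqP ? /eqP ?]; apply: not_shift; exists s.
Qed.
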